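(* Let $\mathcal{H}$ be a hypergraph on a finite totally ordered set $V$, with associated simplicial complex $\Delta\mathcal{H}$, and let $R$ be a commutative ring with unit $1\neq 0$. Let $\overline f:\Delta\mathcal{H}\to\mathbb{R}$ be a discrete Morse function on $\Delta\mathcal{H}$, let $f=\overline f|_{\mathcal{H}}$ (a discrete Morse function on $\mathcal{H}$), and let $\overline{\mathbb{V}}=\operatorname{grad}\overline f$ be the discrete gradient vector field of $\overline f$ on $\Delta\mathcal{H}$, with induced $R$-linear map $R(\overline{\mathbb{V}})$. Let $\sigma\in\mathcal{H}$. Then $$\sigma\in M(f,\mathcal{H})\setminus\big(M(\overline f,\Delta\mathcal{H})\cap\mathcal{H}\big)$$ if and only if one of the following holds: (i) $R(\overline{\mathbb{V}})(\sigma)=\pm\eta$ for some $\eta\in\Delta\mathcal{H}\setminus\mathcal{H}$, and $R(\overline{\mathbb{V}})(\tau)\neq\pm\sigma$ for any $\tau\in\Delta\mathcal{H}$; (ii) $R(\overline{\mathbb{V}})(\sigma)=\pm\eta$ for some $\eta\in\Delta\mathcal{H}\setminus\mathcal{H}$, and there exists $\tau\in\Delta\mathcal{H}\setminus\mathcal{H}$ such that $R(\overline{\mathbb{V}})(\tau)=\pm\sigma$; (iii) $R(\overline{\mathbb{V}})(\sigma)=0$, and there exists $\tau\in\Delta\mathcal{H}\setminus\mathcal{H}$ such that $R(\overline{\mathbb{V}})(\tau)=\pm\sigma$.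
   Context: A hypergraph $\mathcal{H}$ on $V$ is a set of non-empty subsets of $V$ (hyperedges); a hyperedge $\alpha$ with $n+1$ elements has dimension $n$, written $\alpha^{(n)}$; $\alpha<\beta$ means proper inclusion. A simplicial complex is a hypergraph closed under taking non-empty subsets of hyperedges (its hyperedges are called simplices); $\Delta\mathcal{H}$ is the smallest simplicial complex containing $\mathcal{H}$, i.e. the set of all non-empty subsets of hyperedges of $\mathcal{H}$. For a hypergraph $\mathcal{G}$, a function $h:\mathcal{G}\to\mathbb{R}$ is a discrete Morse function on $\mathcal{G}$ if for every $n\ge0$ and $\alpha^{(n)}\in\mathcal{G}$: $\#\{\beta^{(n+1)}>\alpha\mid h(\beta)\le h(\alpha),\beta\in\mathcal{G}\}\le1$ and $\#\{\gamma^{(n-1)}<\alpha\mid h(\gamma)\ge h(\alpha),\gamma\in\mathcal{G}\}\le1$. The hyperedge $\alpha$ is critical if both of these sets are empty; $M(h,\mathcal{G})$ is the set of critical hyperedges. The gradient $\operatorname{grad}h$ is the collection of all pairs $\{\alpha^{(n)}<\beta^{(n+1)}\}$ of hyperedges of $\mathcal{G}$, $n\ge0$, with $h(\beta)\le h(\alpha)$. Let $R(\mathcal{G})_n$ be the free $R$-module on the $n$-hyperedges of $\mathcal{G}$. The $R$-linear map $R(\operatorname{grad}h):R(\mathcal{G})_n\to R(\mathcal{G})_{n+1}$ sends $\alpha^{(n)}\in\mathcal{G}$ to $-\langle\partial\beta,\alpha\rangle\beta$ if $\{\alpha^{(n)}<\beta^{(n+1)}\}\in\operatorname{grad}h$ for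 some (necessarily unique) $\beta$, and to $0$ if there is no such $\beta$. Here $\langle\partial\beta,\alpha\rangle=\pm1$ is the coefficient of $\alpha$ in the simplicial boundary $\partial\{v_0\prec\dots\prec v_{n+1}\}=\sum_i(-1)^i\{v_0,\dots,\widehat{v_i},\dots,v_{n+1}\}$ of $\beta$. *)

(* Defs.v *)
From HB Require Import structures.
From mathcomp Require Import all_boot all_order all_algebra.
From mathcomp Require Import reals.
Set Implicit Arguments.
Unset Strict Implicit.
Unset Printing Implicit Defensive.
Import Order.TTheory GRing.Theory Num.Theory.
Local Open Scope ring_scope.

Record hypergraph (V : finType) := Hypergraph {
  edges :> {set {set V}};
  edges_neq0 : set0 \notin edges }.

Notation hyperedge G := {a : {set _} | a \in edges G}.

Lemma Delta_subproof (V : finType) (H : hypergraph V) :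
  set0 \notin [set a : {set V} | (a != set0) && [exists b in edges H, a \subset b]].
Proof. by rewrite inE eqxx. Qed.

Definition Delta (V : finType) (H : hypergraph V) : hypergraph V :=
  Hypergraph (Delta_subproof H).

Lemma sub_Delta (V : finType) (H : hypergraph V) (a : {set V}) :
  a \in edges H -> a \in edges (Delta H).
Proof.
move=> aH; rewrite inE; apply/andP; split.
  by apply: contraNneq (edges_neq0 H) => <-.
by apply/existsP; exists a; rewrite aH subxx.
Qed.

Definition incl (V : finType) (H : hypergraph V) (a : hyperedge H) :
    hyperedge (Delta H) :=
  exist _ (val a) (sub_Delta (valP a)).

Definition restriction (V : finType) (H : hypergraph V) (T : Type)
    (f : hyperedge (Delta H) -> T) : hyperedge H -> T :=
  fun a => f (incl a).

(* Hyperedges are non-empty, so the truncated predecessor is exact on them. *)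
Definition dim (V : finType) (a : {set V}) : nat := #|a|.-1.

Definition facet (V : finType) (a b : {set V}) : bool :=
  (a \proper b) && (dim b == (dim a).+1).

Section Morse.
Variables (V : finType) (G : hypergraph V) (F : realType).
Variable h : hyperedge G -> F.

Definition upper (a : hyperedge G) : {set hyperedge G} :=
  [set b : hyperedge G | facet (val a) (val b) & h b <= h a].

Definition lower (a : hyperedge G) : {set hyperedge G} :=
  [set c : hyperedge G | facet (val c) (val a) & h c >= h a].

Definition discrete_Morse : Prop :=
  forall a : hyperedge G, (#|upper a| <= 1)%N /\ (#|lower a| <= 1)%N.

Definition critical (a : hyperedge G) : bool :=
  (upper a == set0) && (lower a == set0).

(* As a set of subsets of [V], so that critical sets of different hypergraphs
   on [V] can be compared. *)
Definition M : {set {set V}} :=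
  [set val a | a : hyperedge G & critical a].

Definition grad : {set hyperedge G * hyperedge G} :=
  [set p : hyperedge G * hyperedge G |
     facet (val p.1) (val p.2) & h p.2 <= h p.1].

End Morse.

(* The free R-module on a finite type T is [{ffun T -> R^o}]; the regular module
   [R^o] provides the scaling. *)
Definition gen (R : comNzRingType) (T : finType) (t : T) : {ffun T -> R^o} :=
  [ffun s => (s == t)%:R].
Arguments gen R {T} t.

(* If b = {v_0 < ... < v_n} and v = v_i, then i is the number of elements of b
   below v. The condition [b :\ v != set0] makes the boundary of a vertex 0. *)
Definition boundary (d : Order.disp_t) (V : finOrderType d) (R : comNzRingType)
    (b : {set V}) : {ffun {set V} -> R^o} :=
  \sum_(v in b | b :\ v != set0)
     (-1) ^+ #|[set w in b | (w < v)%O]| *: gen R (b :\ v).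
Arguments boundary {d V} R b.

Section InducedMap.
Variables (d : Order.disp_t) (V : finOrderType d) (R : comNzRingType).
Variables (G : hypergraph V) (W : {set hyperedge G * hyperedge G}).

(* The free module on all the hyperedges of G is the direct sum over n of the
   modules R(G)_n. The map below is the sum of its components
   R(G)_n -> R(G)_(n+1); see [induced_grad_homogeneous]. *)
Definition homogeneous (n : nat) (x : {ffun hyperedge G -> R^o}) : Prop :=
  forall a, x a != 0 -> dim (val a) = n.

(* The partner b of a is unique when W is the gradient of a discrete Morse
   function, so the choice made by [pick] is then immaterial. *)
Definition induced_gen (a : hyperedge G) : {ffun hyperedge G -> R^o} :=
  if [pick b : hyperedge G | (a, b) \in W] is Some b
  then - boundary R (val b) (val a) *: gen R b
  else 0.

Definition induced (x : {ffun hyperedge G -> R^o}) : {ffun hyperedge G -> R^o} :=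
  \sum_(a : hyperedge G) x a *: induced_gen a.

Fact induced_is_linear : linear induced.
Proof.
move=> k x y; rewrite /induced scaler_sumr -big_split; apply: eq_bigr => a _ /=.
by rewrite !ffunE scalerDl scalerA.
Qed.

HB.instance Definition _ :=
  GRing.isLinear.Build R {ffun hyperedge G -> R^o} {ffun hyperedge G -> R^o} _
    induced induced_is_linear.

Lemma induced_on_gen (a : hyperedge G) : induced (gen R a) = induced_gen a.
Proof.
rewrite /induced (bigD1 a) //= big1 ?addr0 ?ffunE ?eqxx ?scale1r // => b /negPf ba.
by rewrite ffunE ba scale0r.
Qed.

End InducedMap.
Arguments induced {d V} R {G} W x.

Lemma induced_grad_homogeneous (d : Order.disp_t) (V : finOrderType d)
    (R : comNzRingType) (G : hypergraph V) (F : realType) (h : hyperedge G -> F)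
    (n : nat) (x : {ffun hyperedge G -> R^o}) :
  homogeneous n x -> homogeneous n.+1 (induced R (grad h) x).
Proof.
move=> hx b; apply: contraNeq => dimb.
rewrite /induced sum_ffunE big1 // => a _.
rewrite !ffunE /induced_gen; case: pickP => [c|_]; last by rewrite ffunE scaler0.
rewrite inE /= => /andP[/andP[_ /eqP dc] _].
have [->|xa] := eqVneq (x a) 0; first by rewrite ?(mul0r, scale0r).
rewrite !ffunE; case: eqVneq => [bc|_]; last by rewrite ?(mulr0, scaler0).
by move: dimb; rewrite bc dc (hx _ xa) eqxx.
Qed.

Definition eq_pm (U : zmodType) (x y : U) : Prop := x = y \/ x = - y.

(* Main.v *)
Require Import Defs.
From HB Require Import structures.
From mathcomp Require Import all_boot all_order all_algebra.
From mathcomp Require Import reals.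
Set Implicit Arguments.
Unset Strict Implicit.
Unset Printing Implicit Defensive.
Import Order.TTheory GRing.Theory Num.Theory.
Local Open Scope ring_scope.

(** The linear map induced by the gradient reads off the partners of a
    hyperedge.  The coefficient of a facet [a] in the boundary of [b] is a sign
    ([boundary_facet]), so [a] is sent to plus or minus [b] when [b] is the
    partner of [a] above, which a discrete Morse function makes unique, and to
    [0] when there is none.  Since the generators are non-zero and distinct up to
    sign, these values determine [upper h a] ([eq_pm_induced], [induced_eq0]).
    As [lower] is the converse relation of [upper], the values of the map decide
    both halves of criticality.

    Restricting the function from [Delta H] to [H] only deletes the partners
    that are not in [H].  So a hyperedge of [H] is critical for the restriction
    exactly when all its partners in [Delta H] are outside [H]
    ([upper_restriction_eq0], [lower_restriction_eq0]), and it is not already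
    critical in [Delta H] exactly when it has a partner.  The three cases of the
    theorem say where the partners are: only above, on both sides, or only
    below.  In the backward direction one partner outside [H] suffices on each
    side, because a discrete Morse function allows no second one there. *)

Lemma facet_setD1 (V : finType) (a b : {set V}) :
  a != set0 -> facet a b -> exists2 v, v \in b & a = b :\ v.
Proof.
move=> a0 /andP[/andP[ab _] /eqP dab].
have : #|b :\: a| == 1%N.
  (* non-emptiness of [a] makes the truncated predecessor in [dim a] exact *)
  have ca : (0 < #|a|)%N by rewrite card_gt0.
  move: dab; rewrite /Defs.dim cardsDS // prednK // => cb.
  by rewrite -(prednK (leq_trans ca (subset_leq_card ab))) cb subSnn.
case/cards1P=> v bv; exists v.
  by have := set11 v; rewrite -bv => /setDP[].
by rewrite -bv setDDr setDv set0U (setIidPr ab).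
Qed.

Lemma gen_neq0 (R : comNzRingType) (T : finType) (t : T) : gen R t != 0.
Proof.
by apply/eqP => /ffunP/(_ t)/eqP; rewrite !ffunE eqxx oner_eq0.
Qed.

Lemma eq_pm_gen (R : comNzRingType) (T : finType) (t u : T) :
  eq_pm (gen R t) (gen R u) -> t = u.
Proof.
move=> tu; apply/eqP/negPn/negP => /negPf t_neq_u.
by case: tu => /ffunP/(_ t)/eqP; rewrite !ffunE eqxx t_neq_u ?oppr0 oner_eq0.
Qed.

Section Partners.
Variables (V : finType) (G : hypergraph V) (F : realType).
Variables (h : hyperedge G -> F) (a : hyperedge G).

Lemma upper_uniq (b c : hyperedge G) : discrete_Morse h ->
  b \in upper h a -> c \in upper h a -> b = c.
Proof. by move=> hM bU cU; have [/card_le1_eqP U _] := hM a; exact: U. Qed.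

Lemma mem_lower (c : hyperedge G) : (c \in lower h a) = (a \in upper h c).
Proof. by rewrite !inE. Qed.

Lemma mem_M : (val a \in M h) = critical h a.
Proof. by rewrite mem_imset ?inE //; exact: val_inj. Qed.

End Partners.

Section InducedMapOfGradient.
Variables (d : Order.disp_t) (V : finOrderType d) (R : comNzRingType).

(** Removing different vertices from [b] leaves different faces, so only one term
    of the boundary contributes to the coefficient and no cancellation occurs. *)
Lemma boundary_facet (a b : {set V}) :
  a != set0 -> facet a b -> exists n, boundary R b a = (-1) ^+ n.
Proof.
move=> a0 /(facet_setD1 a0)[v vb av]; subst a.
exists #|[set w in b | (w < v)%O]|.
rewrite /boundary sum_ffunE (bigD1 v) ?vb ?a0 //= !ffunE eqxx.
rewrite big1 => [|w /andP[/andP[wb _] wv]]; first by rewrite addr0; apply: mulr1.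
rewrite !ffunE; case: eqP => [bvw|_]; last exact: mulr0.
(* [v] is in [b :\ w] but not in [b :\ v] *)
by have := setD11 v b; rewrite bvw !inE vb eq_sym wv.
Qed.

Variables (G : hypergraph V) (F : realType) (h : hyperedge G -> F).

(** The value of the map involves a choice of partner and the sign of an
    incidence number; both are hidden here, and the two comparisons below need
    nothing else about the map. *)
Lemma induced_spec (a : hyperedge G) :
  (upper h a = set0 /\ induced R (grad h) (gen R a) = 0)
  \/ exists2 b, b \in upper h a
     & eq_pm (induced R (grad h) (gen R a)) (gen R b).
Proof.
rewrite induced_on_gen /induced_gen; case: pickP => [b|no_b].
  rewrite inE /= => ab; right; exists b; first by rewrite inE.
  case/andP: ab => ab _.
  have a0 : val a != set0.
    by apply: contraNneq (edges_neq0 G) => <-; exact: valP.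
  have [n ->] := boundary_facet a0 ab.
  rewrite -signr_odd; case: (odd n).
    by left; rewrite expr1 opprK scale1r.
  by right; rewrite expr0 scaleN1r.
left; split=> //; apply/setP => b; rewrite !inE.
by have := no_b b; rewrite inE.
Qed.

Lemma induced_eq0 (a : hyperedge G) :
  induced R (grad h) (gen R a) = 0 <-> upper h a = set0.
Proof.
have [[-> ->]|[b bU ab]] := induced_spec a; first by [].
split=> a0; last by rewrite a0 inE in bU.
case: ab; rewrite a0 => /eqP; rewrite eq_sym ?oppr_eq0;
  by rewrite (negPf (gen_neq0 _ _)).
Qed.

Lemma eq_pm_induced (a b : hyperedge G) : discrete_Morse h ->
  eq_pm (induced R (grad h) (gen R a)) (gen R b) <-> b \in upper h a.
Proof.
move=> hM; have [[-> ->]|[c cU ac]] := induced_spec a.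
  rewrite inE; split=> // -[] /eqP; rewrite eq_sym ?oppr_eq0;
    by rewrite (negPf (gen_neq0 _ _)).
split=> [ab|bU]; last by rewrite (upper_uniq hM bU cU).
suff -> : b = c by [].
apply: (@eq_pm_gen R); case: ab ac => -> [] E.
- by left.
- by right.
- by right; rewrite -E opprK.
- by left; apply: oppr_inj.
Qed.

End InducedMapOfGradient.

Section Restriction.
Variables (V : finType) (H : hypergraph V) (F : realType).
Variables (h : hyperedge (Delta H) -> F) (a : hyperedge H).

Lemma inclP (c : hyperedge (Delta H)) :
  val c \in edges H -> exists b : hyperedge H, c = incl b.
Proof. by move=> cH; exists (exist _ (val c) cH); apply: val_inj. Qed.

(** A partner in [Delta H] that lies in [H] is still a partner for the
    restriction, since facets and values are computed alike in both. *)
Lemma upper_restriction_eq0 :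
  upper (restriction h) a = set0
  <-> forall c, c \in upper h (incl a) -> val c \notin edges H.
Proof.
split=> [U0 c cU|noU].
  apply/negP => /inclP[b cb]; have : b \in upper (restriction h) a.
    by move: cU; rewrite cb !inE.
  by rewrite U0 inE.
apply/setP => b; have := noU (incl b); rewrite !inE => nob.
by apply/negP => /nob/negP[]; exact: (valP b).
Qed.

Lemma lower_restriction_eq0 :
  lower (restriction h) a = set0
  <-> forall c, c \in lower h (incl a) -> val c \notin edges H.
Proof.
split=> [L0 c cL|noL].
  apply/negP => /inclP[b cb]; have : b \in lower (restriction h) a.
    by move: cL; rewrite cb !inE.
  by rewrite L0 inE.
apply/setP => b; have := noL (incl b); rewrite !inE => nob.
by apply/negP => /nob/negP[]; exact: (valP b).
Qed.

End Restriction.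

Theorem theorem5p4 (d : Order.disp_t) (V : finOrderType d) (H : hypergraph V)
    (R : comNzRingType) (F : realType)
    (fbar : hyperedge (Delta H) -> F) (fbarM : discrete_Morse fbar)
    (sigma : hyperedge H) :
  let f : hyperedge H -> F := restriction fbar in
  let RV := induced R (grad fbar) in
  let s := gen R (incl sigma) in
  val sigma \in M f :\: (M fbar :&: edges H)
  <->
  [\/ (exists eta : hyperedge (Delta H),
         val eta \notin edges H /\ eq_pm (RV s) (gen R eta))
      /\ (forall tau : hyperedge (Delta H), ~ eq_pm (RV (gen R tau)) s),
      (exists eta : hyperedge (Delta H),
         val eta \notin edges H /\ eq_pm (RV s) (gen R eta))
      /\ (exists tau : hyperedge (Delta H),
            val tau \notin edges H /\ eq_pm (RV (gen R tau)) s)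
    | RV s = 0
      /\ (exists tau : hyperedge (Delta H),
            val tau \notin edges H /\ eq_pm (RV (gen R tau)) s)].
Proof.
move=> f RV s; set S := incl sigma.
have RVs b : eq_pm (RV s) (gen R b) <-> b \in upper fbar S.
  exact: eq_pm_induced.
have RVt t : eq_pm (RV (gen R t)) s <-> t \in lower fbar S.
  by rewrite mem_lower; exact: eq_pm_induced.
have RV0 : RV s = 0 <-> upper fbar S = set0 by exact: induced_eq0.
have uniqL b c : b \in lower fbar S -> c \in lower fbar S -> b = c.
  by move=> bL cL; have [_ /card_le1_eqP L] := fbarM S; exact: L.
have -> : (val sigma \in M f :\: (M fbar :&: edges H))
          = critical f sigma && ~~ critical fbar S.
  rewrite in_setD in_setI (valP sigma) andbT mem_M andbC.
  by congr (_ && ~~ _); exact: (mem_M fbar S).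
have [UN LN] := (upper_restriction_eq0 fbar sigma,
                 lower_restriction_eq0 fbar sigma).
have critf : (forall c, c \in upper fbar S -> val c \notin edges H) ->
    (forall c, c \in lower fbar S -> val c \notin edges H) -> critical f sigma.
  by move=> /UN U0 /LN L0; rewrite /critical U0 L0 eqxx.
have ncritU b : b \in upper fbar S -> ~~ critical fbar S.
  by apply: contraL => /andP[/eqP-> _]; rewrite inE.
have ncritL b : b \in lower fbar S -> ~~ critical fbar S.
  by apply: contraL => /andP[_ /eqP->]; rewrite inE.
split.
  move=> /andP[/andP[/eqP/UN noU /eqP/LN noL]].
  rewrite /critical; have [U0|[eta etaU]] := set_0Vmem (upper fbar S).
    rewrite U0 eqxx /= => /set0Pn[tau tauL]; apply: Or33.
    split; first by apply/RV0.
    by exists tau; split; [exact: noL | apply/RVt].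
  have exU : exists eta : hyperedge (Delta H),
      val eta \notin edges H /\ eq_pm (RV s) (gen R eta).
    by exists eta; split; [exact: noU | apply/RVs].
  have [L0|[tau tauL]] := set_0Vmem (lower fbar S) => _.
    by apply: Or31; split; [exact: exU | move=> tau /RVt; rewrite L0 inE].
  apply: Or32; split; first exact: exU.
  by exists tau; split; [exact: noL | apply/RVt].
case=> [] [].
- move=> [eta [etaH /RVs etaU]] noL; rewrite (ncritU _ etaU) andbT.
  apply: critf => c cS; last by case: (noL c); apply/RVt.
  by rewrite (upper_uniq fbarM cS etaU).
- move=> [eta [etaH /RVs etaU]] [tau [tauH /RVt tauL]].
  rewrite (ncritU _ etaU) andbT; apply: critf => c cS.
    by rewrite (upper_uniq fbarM cS etaU).
  by rewrite (uniqL _ _ cS tauL).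
- move=> /RV0 U0 [tau [tauH /RVt tauL]]; rewrite (ncritL _ tauL) andbT.
  by apply: critf => c cS; [rewrite U0 inE in cS | rewrite (uniqL _ _ cS tauL)].
Qed.
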